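(* Let each $\ell_i:\mathbb{R}\to\mathbb{R}$ ($i\in[n]$) be convex and $L_i$-smooth with $L_i>0$, let $f(\mathbf{x})=\frac1n\sum_{i=1}^n\ell_i(\mathbf{a}_i^\top\mathbf{x})$ have a minimizer $\mathbf{x}_*\in\mathbb{R}^d$, and let $\sigma_*^2=\frac1n\sum_{i=1}^n(\ell_i'(\mathbf{a}_i^\top\mathbf{x}_* ))^2\|\mathbf{a}_i\|_2^2$ (assumed finite). Run shuffled SGD (Algorithm 1, described in the context) for $K\ge1$ epochs with batch size $b$ and a fixed permutation $\pi^{(k)}=\pi^{(0)}$ for all $k$, and write $\hat L_0=\hat L_{\pi^{(0)}}$, $\tilde L_0=\tilde L_{\pi^{(0)}}$. If the step sizes satisfy $0<\eta_k\le\frac{b}{n\sqrt{2\hat L_0\tilde L_0}}$ for all $k\in[K]$ and $H_K=\sum_{k=1}^K\eta_k$, then the output $\hat{\mathbf{x}}_K$ satisfies $$H_K\big(f(\hat{\mathbf{x}}_K)-f(\mathbf{x}_* )\big)\le\frac{b}{2n}\|\mathbf{x}_0-\mathbf{x}_*\|_2^2+\sum_{k=1}^K\min\Big\{\frac{\eta_k^3n}{b^2}\hat L_0\tilde L_0\|\mathbf{y}_*\|_{\boldsymbol\Lambda^{-1}}^2,\ \frac{\eta_k^3(n-b)^2}{b^2}\tilde L_0\sigma_*^2\Big\}.$$ Consequently, given $\epsilon>0$, there exists a constant step size $\eta_k=\eta$ such that $f(\hat{\mathbf{x}}_K)-f(\mathbf{x}_* )\le\epsilon$ after a number of individual gradient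 queries bounded by $$\mathcal{O}\Big(\frac{n\sqrt{\hat L_0\tilde L_0}\|\mathbf{x}_0-\mathbf{x}_*\|_2^2}{\epsilon}+\frac{\min\big\{\sqrt{n\hat L_0\tilde L_0}\|\mathbf{y}_*\|_{\boldsymbol\Lambda^{-1}},\,(n-b)\sqrt{\tilde L_0}\,\sigma_*\big\}\|\mathbf{x}_0-\mathbf{x}_*\|_2^2}{\epsilon^{3/2}}\Big);$$ that is, there is an absolute constant $C>0$ such that for every $\epsilon>0$ and every integer $K\ge1$ with $nK$ at least $C$ times the expression inside $\mathcal{O}(\cdot)$, some constant step size $\eta>0$ gives $f(\hat{\mathbf{x}}_K)-f(\mathbf{x}_* )\le\epsilon$.
   Context: Setting: $n,d,b,m\ge 1$ are integers with $n=bm$; $[n]=\{1,\dots,n\}$; $\mathbf{a}_1,\dots,\mathbf{a}_n\in\mathbb{R}^d$. A differentiable $\ell_i$ is $L_i$-smooth if $|\ell_i'(x)-\ell_i'(y)|\le L_i|x-y|$ for all $x,y\in\mathbb{R}$. $\ell_i^*$ denotes the convex conjugate of $\ell_i$. $\|\cdot\|_2$ is the Euclidean norm for vectors and the operator norm for matrices; for positive definite $\mathbf{M}$, $\|\mathbf{y}\|_{\mathbf{M}}=\sqrt{\mathbf{y}^\top\mathbf{M}\mathbf{y}}$. $\boldsymbol\Lambda=\mathrm{diag}(L_1,\dots,L_n)$, and $\mathbf{y}_*\in\mathbb{R}^n$ is the vector with $\mathbf{y}_*^i=\operatorname{argmax}_{y\in\mathbb{R}}\{y\,\mathbf{a}_i^\top\mathbf{x}_*-\ell_i^*(y)\}=\ell_i'(\mathbf{a}_i^\top\mathbf{x}_*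 )$. For a permutation $\pi=(\pi_1,\dots,\pi_n)$ of $[n]$: $\mathbf{A}_\pi=[\mathbf{a}_{\pi_1},\dots,\mathbf{a}_{\pi_n}]^\top\in\mathbb{R}^{n\times d}$ and $\boldsymbol\Lambda_\pi=\mathrm{diag}(L_{\pi_1},\dots,L_{\pi_n})$. $\mathbf{I}_{j\uparrow}$ is the $n\times n$ identity matrix with its first $j$ diagonal entries set to zero; $\mathbf{I}_{(j)}$ is the $n\times n$ diagonal matrix with diagonal entries $1$ in positions $b(j-1)+1,\dots,bj$ and $0$ elsewhere. Define $$\hat L_\pi=\frac1{mn}\Big\|\boldsymbol\Lambda_\pi^{1/2}\Big(\sum_{j=1}^m\mathbf{I}_{b(j-1)\uparrow}\mathbf{A}_\pi\mathbf{A}_\pi^\top\mathbf{I}_{b(j-1)\uparrow}\Big)\boldsymbol\Lambda_\pi^{1/2}\Big\|_2,\qquad \tilde L_\pi=\frac1b\Big\|\boldsymbol\Lambda_\pi^{1/2}\Big(\sum_{j=1}^m\mathbf{I}_{(j)}\mathbf{A}_\pi\mathbf{A}_\pi^\top\mathbf{I}_{(j)}\Big)\boldsymbol\Lambda_\pi^{1/2}\Big\|_2 .$$ A step-size bound with zero denominator is read as $+\infty$ (no restriction). Algorithm 1 (shuffled SGD, primal-dual view). Input: $\mathbf{x}_0\in\mathbb{R}^d$, batch size $b$, step sizes $\eta_k>0$, number of epochs $K$. For $k=1,\dots,K$: choose a permutation $\pi^{(k)}$ of $[n]$ (here always $\pi^{(0)}$); set $\mathbf{A}_k=\mathbf{A}_{\pi^{(k)}}$,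 and let $\mathbf{A}_k^{(i)}\in\mathbb{R}^{b\times d}$ consist of rows $b(i-1)+1,\dots,bi$ of $\mathbf{A}_k$; set $\mathbf{x}_{k-1,1}=\mathbf{x}_{k-1}$; for $i=1,\dots,m$ set $\mathbf{y}_k^{(i)}=\operatorname{argmax}_{\mathbf{y}\in\mathbb{R}^b}\{\mathbf{y}^\top\mathbf{A}_k^{(i)}\mathbf{x}_{k-1,i}-\sum_{j=1}^b\ell^*_{\pi^{(k)}_{b(i-1)+j}}(\mathbf{y}^j)\}$ and $\mathbf{x}_{k-1,i+1}=\operatorname{argmin}_{\mathbf{x}\in\mathbb{R}^d}\{\mathbf{y}_k^{(i)\top}\mathbf{A}_k^{(i)}\mathbf{x}+\frac{b}{2\eta_k}\|\mathbf{x}-\mathbf{x}_{k-1,i}\|_2^2\}$; then set $\mathbf{x}_k=\mathbf{x}_{k-1,m+1}$. Equivalently, $\mathbf{x}_{k-1,i+1}=\mathbf{x}_{k-1,i}-\frac{\eta_k}{b}\sum_{j=b(i-1)+1}^{bi}\ell'_{\pi_j^{(k)}}(\mathbf{a}_{\pi_j^{(k)}}^\top\mathbf{x}_{k-1,i})\,\mathbf{a}_{\pi_j^{(k)}}$. Output: $\hat{\mathbf{x}}_K=\sum_{k=1}^K\eta_k\mathbf{x}_k/\sum_{k=1}^K\eta_k$. Each epoch uses $n$ individual gradient queries. *)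

(* Defs.v *)
(* MathComp-Analysis, over an arbitrary [R : realType].  Vectors are columns.
   Components, positions and mini-batches are numbered from 0, epochs from 1. *)
From mathcomp Require Import all_boot all_order all_fingroup all_algebra.
From mathcomp Require Import all_classical all_reals all_analysis.
Set Implicit Arguments.
Unset Strict Implicit.
Unset Printing Implicit Defensive.
Import Order.TTheory GRing.Theory Num.Theory.
Import numFieldNormedType.Exports.
Local Open Scope classical_set_scope.
Local Open Scope ring_scope.

Definition dotv (R : realType) (n : nat) (u v : 'cV[R]_n) : R :=
  (u^T *m v) 0 0.

(* The library norm on matrices is the sup norm. *)
Definition l2norm (R : realType) (n : nat) (v : 'cV[R]_n) : R :=
  Num.sqrt (dotv v v).

Definition opnorm (R : realType) (m n : nat) (M : 'M[R]_(m, n)) : R :=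
  sup [set l2norm (M *m v) | v in [set v : 'cV[R]_n | l2norm v <= 1]].

Definition wnorm (R : realType) (n : nat) (M : 'M[R]_n) (y : 'cV[R]_n) : R :=
  Num.sqrt (dotv y (M *m y)).

Definition smooth (R : realType) (L : R) (g : R -> R) : Prop :=
  (forall x, derivable g x 1) /\
  (forall x y, `|derive1 g x - derive1 g y| <= L * `|x - y|).

Definition conjugate (R : realType) (g : R -> R) (y : R) : \bar R :=
  ereal_sup [set (y * x - g x)%:E | x in [set: R]].

(* A maximizer (minimizer) of F, and 0 if there is none.  All the extremizers
   below exist and are unique when the losses are convex and differentiable
   and the step sizes are positive. *)
Definition argmax (T : zmodType) (disp : Order.disp_t) (S : porderType disp)
  (F : T -> S) : T := xget 0 [set x | forall z, (F z <= F x)%O].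

Definition argmin (T : zmodType) (disp : Order.disp_t) (S : porderType disp)
  (F : T -> S) : T := xget 0 [set x | forall z, (F x <= F z)%O].

Definition objective (R : realType) (n d : nat) (a : 'I_n -> 'cV[R]_d)
  (l : 'I_n -> R -> R) (x : 'cV[R]_d) : R :=
  n%:R^-1 * \sum_(i < n) l i (dotv (a i) x).

Definition sigma2 (R : realType) (n d : nat) (a : 'I_n -> 'cV[R]_d)
  (l : 'I_n -> R -> R) (x : 'cV[R]_d) : R :=
  n%:R^-1 * \sum_(i < n) (derive1 (l i) (dotv (a i) x)) ^+ 2 * l2norm (a i) ^+ 2.

(* The vector y_* when x is the minimizer x_*. *)
Definition dual_opt (R : realType) (n d : nat) (a : 'I_n -> 'cV[R]_d)
  (l : 'I_n -> R -> R) (x : 'cV[R]_d) : 'cV[R]_n :=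
  \col_(i < n)
    argmax (fun y : R => ((y * dotv (a i) x)%:E - conjugate (l i) y)%E).

Definition Lambda (R : realType) (n : nat) (L : 'I_n -> R) : 'M[R]_n :=
  diag_mx (\row_(i < n) L i).

Definition sqrt_Lambda (R : realType) (n : nat) (L : 'I_n -> R) : 'M[R]_n :=
  diag_mx (\row_(i < n) Num.sqrt (L i)).

Definition data_mx (R : realType) (n d : nat) (a : 'I_n -> 'cV[R]_d) :
  'M[R]_(n, d) := \matrix_(i < n, k < d) a i k 0.

(* The identity with its first j diagonal entries set to zero. *)
Definition I_from (R : realType) (n j : nat) : 'M[R]_n :=
  diag_mx (\row_(p < n) (j <= p)%N%:R).

(* Ones exactly at the positions of the j-th block of size b. *)
Definition I_block (R : realType) (n b j : nat) : 'M[R]_n :=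
  diag_mx (\row_(p < n) (b * j <= p < b * j.+1)%N%:R).

Definition Lhat (R : realType) (n d : nat) (b m : nat) (a : 'I_n -> 'cV[R]_d)
  (L : 'I_n -> R) (s : 'S_n) : R :=
  let A := data_mx (a \o s) in let D := sqrt_Lambda (L \o s) in
  (m%:R * n%:R)^-1 *
  opnorm (D *m (\sum_(j < m)
    (I_from R n (b * j) *m A *m A^T *m I_from R n (b * j))) *m D).

Definition Ltilde (R : realType) (n d : nat) (b m : nat) (a : 'I_n -> 'cV[R]_d)
  (L : 'I_n -> R) (s : 'S_n) : R :=
  let A := data_mx (a \o s) in let D := sqrt_Lambda (L \o s) in
  b%:R^-1 *
  opnorm (D *m (\sum_(j < m)
    (I_block R n b j *m A *m A^T *m I_block R n b j)) *m D).

(* num / den, read as +oo when the denominator is zero. *)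
Definition step_bound (R : realType) (num den : R) : \bar R :=
  if den == 0 then +oo%E else (num / den)%:E.

Lemma block_idx_subproof (n b m : nat) (nbm : n = (b * m)%N)
  (i : 'I_m) (j : 'I_b) : (b * i + j < n)%N.
Proof.
rewrite nbm (@leq_trans (b * i.+1)%N) ?leq_mul2l ?ltn_ord ?orbT//.
by rewrite mulnS addnC ltn_add2r.
Qed.

(* Position of the j-th entry of the i-th mini-batch. *)
Definition block_idx (n b m : nat) (nbm : n = (b * m)%N) (i : 'I_m)
  (j : 'I_b) : 'I_n := Ordinal (block_idx_subproof nbm i j).

Definition batch_mx (R : realType) (n d b m : nat) (nbm : n = (b * m)%N)
  (a : 'I_n -> 'cV[R]_d) (s : 'S_n) (i : 'I_m) : 'M[R]_(b, d) :=
  rowsub (block_idx nbm i) (data_mx (a \o s)).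

Definition dual_step (R : realType) (n d b m : nat) (nbm : n = (b * m)%N)
  (a : 'I_n -> 'cV[R]_d) (l : 'I_n -> R -> R) (s : 'S_n) (i : 'I_m)
  (x : 'cV[R]_d) : 'cV[R]_b :=
  argmax (fun y : 'cV[R]_b =>
    ((dotv y (batch_mx nbm a s i *m x))%:E -
     \sum_(j < b) conjugate (l (s (block_idx nbm i j))) (y j ord0))%E).

Definition primal_step (R : realType) (n d b m : nat) (nbm : n = (b * m)%N)
  (a : 'I_n -> 'cV[R]_d) (l : 'I_n -> R -> R) (s : 'S_n) (eta : R) (i : 'I_m)
  (x : 'cV[R]_d) : 'cV[R]_d :=
  let y := dual_step nbm a l s i x in
  argmin (fun z : 'cV[R]_d =>
    dotv y (batch_mx nbm a s i *m z)
    + b%:R / (2 * eta) * l2norm (z - x) ^+ 2).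

(* One pass over the mini-batches 0, ..., m - 1, in this order. *)
Definition epoch (R : realType) (n d b m : nat) (nbm : n = (b * m)%N)
  (a : 'I_n -> 'cV[R]_d) (l : 'I_n -> R -> R) (s : 'S_n) (eta : R)
  (x : 'cV[R]_d) : 'cV[R]_d :=
  foldl (fun z i => primal_step nbm a l s eta i z) x (enum 'I_m).

(* The iterate x_k; the step sizes and permutations are used from index 1. *)
Fixpoint shuffled_sgd (R : realType) (n d b m : nat) (nbm : n = (b * m)%N)
  (a : 'I_n -> 'cV[R]_d) (l : 'I_n -> R -> R) (s : nat -> 'S_n)
  (eta : nat -> R) (x0 : 'cV[R]_d) (k : nat) : 'cV[R]_d :=
  if k is k'.+1 then
    epoch nbm a l (s k) (eta k) (shuffled_sgd nbm a l s eta x0 k')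
  else x0.

Definition sgd_output (R : realType) (n d b m : nat) (nbm : n = (b * m)%N)
  (a : 'I_n -> 'cV[R]_d) (l : 'I_n -> R -> R) (s : nat -> 'S_n)
  (eta : nat -> R) (x0 : 'cV[R]_d) (K : nat) : 'cV[R]_d :=
  (\sum_(1 <= k < K.+1) eta k)^-1 *:
  \sum_(1 <= k < K.+1) eta k *: shuffled_sgd nbm a l s eta x0 k.

(* Main.v *)
Require Import Defs.
From mathcomp Require Import all_boot all_order all_fingroup all_algebra.
From mathcomp Require Import all_classical all_reals all_analysis.
From mathcomp Require Import ring lra.
Import Order.TTheory GRing.Theory Num.Theory.
Import numFieldNormedType.Exports.
Local Open Scope classical_set_scope.
Local Open Scope ring_scope.

(** In one epoch with step size eta, let z_0, ..., z_m be the inner iterates,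
    g_p the derivative of the loss at position p where the algorithm evaluates
    it (at the iterate z_i opening the block i of p), v_p its derivative at
    the end z_m of the epoch and y_p at the minimizer.  Two applications of the
    co-coercivity of convex smooth functions (convex_smooth_cocoercive) bound
    the loss gap at position p by
      g_p <a_p, z_m - xs> + (v_p - g_p) <a_p, z_m - z_i>
        - (v_p - g_p)^2 / (2 L_p) - (g_p - y_p)^2 / (2 L_p).
    Summed over p, the first term telescopes into squared distances to the
    minimizer, because the sum of the g_p a_p is b / eta times the
    displacement z_0 - z_m.  In the second term Young's inequality spends the
    first negative square: Ltilde is exactly the constant comparing the
    blockwise gradients with the Lambda^-1 norm, and the sum of the
    |z_m - z_i|^2 remains.  Since z_m - z_i is eta / b times a tail of the sum
    of the g_p a_p, the constant Lhat controls this sum; writing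
    g = (g - y) + y, the step size condition lets the last negative square
    absorb the part in g - y, and only the tails of the sum of the y_p a_p
    survive (epoch_descent).

    These tails are the whole error of the epoch.  They are bounded either by
    Lhat, which gives the first member of the minimum, or by stationarity: the
    full sum of the y_p a_p vanishes, so the tail starting at the first block
    costs nothing and the m - 1 others have at most n - b terms each
    (sum_tails_le), which gives the second member.

    Summing over the epochs and using convexity (objective_jensen) yields the
    bound for the weighted average.  For a constant step eta = b t it reads
    gap <= D2 / (2 n K t) + t^2 P^2, with P the minimum in the complexity
    bound.  If D2 > 0, the choice t = D2 / (n K eps) makes the first term
    eps / 2, and the lower bound on n K with constant 2 makes t both
    admissible and small enough for the second (step_choice).

    The algorithm is specified through dual maximizations and proximal
    minimizations; argmax_fenchel and argmin_prox identify them with derivative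
    evaluations and gradient steps. *)

(** * Convex smooth functions of a real variable *)

Lemma eq_ler {R : realType} (x y : R) : x = y -> x <= y.
Proof. by move=> ->. Qed.

(** An infinitesimal quadratic error cannot compensate a first-order term:
    this replaces passages to the limit along a segment. *)
Lemma le0_of_le_small {R : realType} (x c : R) :
  (forall t, 0 < t -> t <= 1 -> x <= t * c) -> x <= 0.
Proof.
move=> h; rewrite leNgt; apply/negP => x0.
have c0 : 0 < c by have := h 1 ltr01 (lexx 1); lra.
have := h 1 ltr01 (lexx 1) => xc.
have t0 : 0 < x / (2 * c) by apply: divr_gt0; lra.
have t1 : x / (2 * c) <= 1 by rewrite ler_pdivrMr; lra.
have := h _ t0 t1.
have -> : x / (2 * c) * c = x / 2 by field; lra.
lra.
Qed.

(** The intermediate point is given by its relative position on the segment,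
    so that the order of the endpoints does not matter. *)
Lemma mean_value_any {R : realType} (g : R -> R) (x y : R) :
  (forall u : R, derivable g u (1 : R)) ->
  exists2 s, 0 <= s <= 1 & g y - g x = derive1 g (x + s * (y - x)) * (y - x).
Proof.
move=> dg.
have ig (u : R) : is_derive u (1 : R) g (derive1 g u).
  by rewrite derive1E; exact: derivableP.
have cg (u v : R) : {within `[u, v], continuous g}.
  by apply: derivable_within_continuous => ? _; exact: dg.
have [xy|yx|->] := ltgtP x y; last by exists 0; rewrite ?lexx ?ler01// !subrr mulr0.
- have [c] := MVT xy (fun u _ => ig u) (cg x y).
  rewrite in_itv/= => /andP[xc cy] ->.
  exists ((c - x) / (y - x)).
    by rewrite divr_ge0 ?ler_pdivrMr; lra.
  by congr (derive1 g _ * _); field; lra.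
- have [c] := MVT yx (fun u _ => ig u) (cg y x).
  rewrite in_itv/= => /andP[xc cy] e.
  exists ((x - c) / (x - y)).
    by rewrite divr_ge0 ?ler_pdivrMr; lra.
  have -> : x + (x - c) / (x - y) * (y - x) = c by field; lra.
  by move: e; lra.
Qed.

(** The difference of the two sides has a derivative whose sign is opposite to
    that of the displacement from x, because the derivative of g grows at rate
    at most L. *)
Lemma smooth_le_quadratic {R : realType} {L : R} {g : R -> R} (x y : R) :
  smooth L g ->
  g y <= g x + derive1 g x * (y - x) + L / 2 * (y - x) ^+ 2.
Proof.
move=> [dg lip].
pose psi : R -> R := fun t => g t - (derive1 g x * (t - x) + L / 2 * (t - x) ^+ 2).
have ipsi (t : R) : is_derive t (1 : R) psi (derive1 g t - (derive1 g x + L * (t - x))).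
  have ig : is_derive t (1 : R) g (derive1 g t) by rewrite derive1E; exact: derivableP.
  apply: is_deriveB.
  apply: is_derive_eq.
  by rewrite /GRing.scale/=; lra.
have dpsi (t : R) : derivable psi t (1 : R) by have [] := ipsi t.
have [s /andP[s0 s1]] := mean_value_any psi x y dpsi.
set c := x + s * (y - x).
have -> : derive1 psi c = derive1 g c - (derive1 g x + L * (c - x)).
  by rewrite derive1E; have [_ ->] := ipsi c.
have := lip c x; have -> : c - x = s * (y - x) by rewrite /c; lra.
rewrite normrM (ger0_norm s0) /psi => lipc e.
have : (derive1 g c - derive1 g x) * (y - x) <= L * s * (y - x) ^+ 2.
  apply: le_trans (ler_norm _) _; rewrite normrM -(real_normK (num_real (y - x))).
  have := ler_wpM2r (normr_ge0 (y - x)) lipc; rewrite expr2; lra.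
by move: e; rewrite !subrr; nra.
Qed.

(** Convexity bounds the slope of the secant from x to a point at relative
    distance t by the slope to y, and by the mean value theorem this secant
    slope is the derivative at x up to an error of order t. *)
Lemma convex_smooth_tangent {R : realType} {L : R} {g : R -> R} (x y : R) :
  convex_function [set: R^o] g -> smooth L g ->
  g x + derive1 g x * (y - x) <= g y.
Proof.
move=> cg [dg lip].
suff : g x + derive1 g x * (y - x) - g y <= 0 by lra.
(* The sign of L is arbitrary here, whence its absolute value. *)
apply: (@le0_of_le_small _ _ (`|L| * (y - x) ^+ 2)) => t t0 t1.
have ht : 0 <= t <= 1 by lra.
have := cg (Itv01 (ltW t0) t1) y x; rewrite !inE => /(_ I I).
rewrite convRE /= /unstable.onem [X in g X <= _](_ : _ = x + t * (y - x)); last first.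
  by rewrite -[LHS]/(t * y + (1 - t) * x); lra.
move=> h.
have [s /andP[s0 s1]] := mean_value_any g x (x + t * (y - x)) dg.
rewrite (_ : x + t * (y - x) - x = t * (y - x)); last by lra.
set c := x + s * _ => e.
have := lip c x; rewrite (_ : c - x = s * t * (y - x)); last by rewrite /c; lra.
rewrite normrM ger0_norm ?mulr_ge0 ?(ltW t0)// => lipc.
have h1 : (derive1 g x - derive1 g c) * (y - x) <= t * (`|L| * (y - x) ^+ 2).
  apply: le_trans (ler_norm _) _; rewrite normrM distrC -(real_normK (num_real (y - x))).
  have L1 : L * (s * t) <= `|L| * t.
    apply: le_trans (_ : `|L| * (s * t) <= _).
      by rewrite ler_wpM2r ?ler_norm ?mulr_ge0 ?(ltW t0).
    by rewrite ler_wpM2l// ler_piMl// ltW.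
  have L2 : `|derive1 g c - derive1 g x| <= `|L| * t * `|y - x|.
    apply: le_trans lipc _; rewrite mulrA ler_wpM2r//.
  by have := ler_wpM2r (normr_ge0 (y - x)) L2; rewrite expr2; lra.
have h2 : t * (derive1 g c * (y - x)) <= t * (g y - g x) by lra.
rewrite ler_pM2l// in h2.
lra.
Qed.

(** Compare the tangent at w with the quadratic upper bound at v, both taken
    at the minimizer v - (p - q) / L of their difference. *)
Lemma convex_smooth_cocoercive {R : realType} {L : R} {g : R -> R} (w v : R) :
  0 < L -> convex_function [set: R^o] g -> smooth L g ->
  g w + derive1 g w * (v - w) + (derive1 g v - derive1 g w) ^+ 2 / (2 * L)
    <= g v.
Proof.
move=> L0 cg sg.
set p := derive1 g v; set q := derive1 g w.
have := convex_smooth_tangent w (v - (p - q) / L) cg sg.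
have := smooth_le_quadratic v (v - (p - q) / L) sg.
rewrite -/p -/q => h1 h2.
have e1 : p * (v - (p - q) / L - v) = - (p * (p - q) / L) by field; lra.
have e2 : L / 2 * (v - (p - q) / L - v) ^+ 2 = (p - q) ^+ 2 / (2 * L) by field; lra.
have e3 : q * (v - (p - q) / L - w) = q * (v - w) - q * (p - q) / L by field; lra.
have e4 : (p - q) ^+ 2 / (2 * L) = (p * (p - q) / L - q * (p - q) / L) / 2 by field; lra.
lra.
Qed.

(** At a point of differentiability the derivative is the only subgradient: a
    displacement by (y - q) / L would make the supporting line of slope y
    cross the quadratic upper bound. This gives the uniqueness of the dual
    maximizers. *)
Lemma subgradient_eq_derive {R : realType} {L : R} {g : R -> R} (u y : R) :
  0 < L -> smooth L g -> (forall x, g u + y * (x - u) <= g x) ->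
  y = derive1 g u.
Proof.
move=> L0 sg h; set q := derive1 g u.
have := h (u + (y - q) / L).
have := smooth_le_quadratic u (u + (y - q) / L) sg; rewrite -/q.
have -> : u + (y - q) / L - u = (y - q) / L by lra.
have -> : L / 2 * ((y - q) / L) ^+ 2 = (y - q) ^+ 2 / L / 2 by field; lra.
move=> h1 h2.
have h3 : (y - q) ^+ 2 / L <= 0.
  have -> : (y - q) ^+ 2 / L = y * ((y - q) / L) - q * ((y - q) / L) by field; lra.
  lra.
have : (y - q) ^+ 2 <= 0 by move: h3; rewrite ler_pdivrMr// mul0r.
have := sqr_ge0 (y - q).
move=> a b; have /eqP : (y - q) ^+ 2 = 0 by lra.
by rewrite sqrf_eq0 subr_eq0 => /eqP.
Qed.

(** * Euclidean vectors and the operator norm *)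

Lemma dotvE {R : realType} {n : nat} (u v : 'cV[R]_n) :
  dotv u v = \sum_i u i 0 * v i 0.
Proof. by rewrite /dotv mxE; apply: eq_bigr => i _; rewrite mxE. Qed.

Lemma dotvC {R : realType} {n : nat} (u v : 'cV[R]_n) : dotv u v = dotv v u.
Proof. by rewrite !dotvE; apply: eq_bigr => i _; rewrite mulrC. Qed.

Lemma dotvDr {R : realType} {n : nat} (u v w : 'cV[R]_n) :
  dotv u (v + w) = dotv u v + dotv u w.
Proof. by rewrite /dotv mulmxDr mxE. Qed.

Lemma dotvNr {R : realType} {n : nat} (u v : 'cV[R]_n) :
  dotv u (- v) = - dotv u v.
Proof. by rewrite /dotv mulmxN mxE. Qed.

Lemma dotvZr {R : realType} {n : nat} (u v : 'cV[R]_n) (c : R) :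
  dotv u (c *: v) = c * dotv u v.
Proof. by rewrite /dotv -scalemxAr mxE. Qed.

Lemma dotvBr {R : realType} {n : nat} (u v w : 'cV[R]_n) :
  dotv u (v - w) = dotv u v - dotv u w.
Proof. by rewrite dotvDr dotvNr. Qed.

Lemma dotvDl {R : realType} {n : nat} (u v w : 'cV[R]_n) :
  dotv (v + w) u = dotv v u + dotv w u.
Proof. by rewrite dotvC dotvDr !(dotvC u). Qed.

Lemma dotvNl {R : realType} {n : nat} (u v : 'cV[R]_n) :
  dotv (- v) u = - dotv v u.
Proof. by rewrite dotvC dotvNr dotvC. Qed.

Lemma dotvZl {R : realType} {n : nat} (u v : 'cV[R]_n) (c : R) :
  dotv (c *: v) u = c * dotv v u.
Proof. by rewrite dotvC dotvZr dotvC. Qed.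

Lemma dotvBl {R : realType} {n : nat} (u v w : 'cV[R]_n) :
  dotv (v - w) u = dotv v u - dotv w u.
Proof. by rewrite dotvDl dotvNl. Qed.

Lemma dotv_sumr {R : realType} {n : nat} (I : Type) (r : seq I) (P : pred I)
    (u : 'cV[R]_n) (v : I -> 'cV[R]_n) :
  dotv u (\sum_(i <- r | P i) v i) = \sum_(i <- r | P i) dotv u (v i).
Proof. by rewrite /dotv mulmx_sumr summxE. Qed.

Lemma dotv_suml {R : realType} {n : nat} (I : Type) (r : seq I) (P : pred I)
    (u : 'cV[R]_n) (v : I -> 'cV[R]_n) :
  dotv (\sum_(i <- r | P i) v i) u = \sum_(i <- r | P i) dotv (v i) u.
Proof. by rewrite dotvC dotv_sumr; apply: eq_bigr => i _; rewrite dotvC. Qed.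

Lemma dotv_mulmx {R : realType} {m n : nat} (A : 'M[R]_(m, n)) u v :
  dotv u (A *m v) = dotv (A^T *m u) v.
Proof. by rewrite /dotv trmx_mul trmxK mulmxA. Qed.

Lemma dotv_ge0 {R : realType} {n : nat} (u : 'cV[R]_n) : 0 <= dotv u u.
Proof. by rewrite dotvE sumr_ge0// => i _; rewrite -expr2 sqr_ge0. Qed.

Lemma dotv_eq0 {R : realType} {n : nat} (u : 'cV[R]_n) : dotv u u <= 0 -> u = 0.
Proof.
move=> h; have /eqP : dotv u u = 0 by apply/eqP; rewrite eq_le h dotv_ge0.
rewrite dotvE psumr_eq0; last by move=> i _; rewrite -expr2 sqr_ge0.
move=> /allP u0; apply/colP => i; rewrite mxE.
by have := u0 i (mem_index_enum i); rewrite -expr2 sqrf_eq0 => /eqP.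
Qed.

Lemma l2norm_sqr {R : realType} {n : nat} (u : 'cV[R]_n) :
  l2norm u ^+ 2 = dotv u u.
Proof. by rewrite sqr_sqrtr// dotv_ge0. Qed.

Lemma l2norm_ge0 {R : realType} {n : nat} (u : 'cV[R]_n) : 0 <= l2norm u.
Proof. exact: sqrtr_ge0. Qed.

Lemma dotv_young {R : realType} {n : nat} (u v : 'cV[R]_n) :
  2 * dotv u v <= dotv u u + dotv v v.
Proof.
by have := dotv_ge0 (u - v); rewrite dotvBl !dotvBr (dotvC v u); lra.
Qed.

(** Expand the square of the residual (v.v) u - (u.v) v, which avoids dividing
    by v.v. *)
Lemma dotv_cauchy_schwarz {R : realType} {n : nat} (u v : 'cV[R]_n) :
  dotv u v ^+ 2 <= dotv u u * dotv v v.
Proof.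
have [|v0] := ltP 0 (dotv v v); last first.
  rewrite (dotv_eq0 v v0) (_ : dotv u 0 = 0) ?expr0n.
    by rewrite mulr_ge0 ?dotv_ge0.
  by rewrite /dotv mulmx0 mxE.
move=> v0.
have := dotv_ge0 (dotv v v *: u - dotv u v *: v).
rewrite dotvBl !dotvBr !dotvZl !dotvZr (dotvC v u) => h.
suff : 0 <= dotv v v * (dotv u u * dotv v v - dotv u v ^+ 2).
  by rewrite pmulr_rge0// subr_ge0.
by apply: le_trans h _; apply: eq_ler; ring.
Qed.

Lemma dotv_le_l2norm {R : realType} {n : nat} (u v : 'cV[R]_n) :
  dotv u v <= l2norm u * l2norm v.
Proof.
apply: le_trans (ler_norm _) _.
rewrite -(ler_pXn2r (n := 2)) ?nnegrE ?mulr_ge0 ?l2norm_ge0//.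
by rewrite real_normK ?num_real// exprMn !l2norm_sqr dotv_cauchy_schwarz.
Qed.

(** Expand the square and apply Young's inequality to each cross product. *)
Lemma dotv_sum_le {R : realType} {n : nat} {I : finType} (P : pred I)
    (v : I -> 'cV[R]_n) :
  dotv (\sum_(i | P i) v i) (\sum_(i | P i) v i)
    <= #|P|%:R * \sum_(i | P i) dotv (v i) (v i).
Proof.
rewrite dotv_suml.
apply: (@le_trans _ _ (\sum_(i | P i) \sum_(j | P j)
    (dotv (v i) (v i) + dotv (v j) (v j)) / 2)).
  apply: ler_sum => i _; rewrite dotv_sumr; apply: ler_sum => j _.
  by have := dotv_young (v i) (v j); lra.
under eq_bigr => i _ do rewrite -mulr_suml big_split/= sumr_const.
rewrite -mulr_suml big_split/= sumr_const sumrMnl mulr_natl.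
by move: (_ *+ #|P|) => T; lra.
Qed.

(** The operator norm is defined as a supremum, which is only meaningful for a
    bounded set; the Frobenius norm is a bound. *)
Lemma l2norm_mulmx_bounded {R : realType} {m n : nat} (M : 'M[R]_(m, n)) :
  exists c, forall v, l2norm v <= 1 -> l2norm (M *m v) <= c.
Proof.
exists (Num.sqrt (\sum_i dotv (row i M)^T (row i M)^T)) => v v1.
rewrite /l2norm ler_wsqrtr// dotvE; apply: ler_sum => i _.
have -> : (M *m v) i 0 = dotv (row i M)^T v.
  by rewrite dotvE mxE; apply: eq_bigr => j _; rewrite !mxE.
rewrite -expr2; apply: le_trans (dotv_cauchy_schwarz _ _) _.
rewrite ler_piMr ?dotv_ge0// -l2norm_sqr -(expr1n _ 2).
by rewrite lerXn2r ?nnegrE ?l2norm_ge0.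
Qed.

Lemma l2norm0 {R : realType} {n : nat} : l2norm (0 : 'cV[R]_n) = 0.
Proof. by rewrite /l2norm /dotv mulmx0 mxE sqrtr0. Qed.

Lemma opnorm_has_sup {R : realType} {m n : nat} (M : 'M[R]_(m, n)) :
  has_sup [set l2norm (M *m v) | v in [set v : 'cV[R]_n | l2norm v <= 1]].
Proof.
split; first by exists (l2norm (M *m 0)), 0 => //=; rewrite l2norm0.
have [c hc] := l2norm_mulmx_bounded M.
by exists c => _ [v /= v1 <-]; exact: hc.
Qed.

Lemma opnorm_ge0 {R : realType} {m n : nat} (M : 'M[R]_(m, n)) : 0 <= opnorm M.
Proof.
apply: sup_upper_bound (opnorm_has_sup M) _ _.
by exists 0; rewrite /= ?mulmx0 l2norm0.
Qed.

Lemma l2norm_mulmx_le {R : realType} {m n : nat} (M : 'M[R]_(m, n)) v :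
  l2norm (M *m v) <= opnorm M * l2norm v.
Proof.
have [v0|] := ltP 0 (l2norm v); last first.
  move=> v0; have -> : v = 0.
    apply: dotv_eq0; rewrite -l2norm_sqr.
    have -> : l2norm v = 0 by apply/eqP; rewrite eq_le v0 l2norm_ge0.
    by rewrite expr0n.
  by rewrite mulmx0 !l2norm0 mulr0.
have l2Z k (w : 'cV[R]_k) c : 0 <= c -> l2norm (c *: w) = c * l2norm w.
  move=> c0; rewrite /l2norm dotvZl dotvZr mulrA -expr2 sqrtrM ?sqr_ge0//.
  by rewrite sqrtr_sqr ger0_norm.
have i0 : 0 <= (l2norm v)^-1 by rewrite invr_ge0 l2norm_ge0.
rewrite -ler_pdivrMr// mulrC -l2Z// scalemxAr.
apply: sup_upper_bound (opnorm_has_sup M) _ _ => /=.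
by exists ((l2norm v)^-1 *: v) => //=; rewrite l2Z// mulVf ?gt_eqF.
Qed.

Lemma quadratic_form_le_opnorm {R : realType} {n : nat} (M : 'M[R]_n) u :
  dotv u (M *m u) <= opnorm M * dotv u u.
Proof.
apply: le_trans (dotv_le_l2norm _ _) _.
rewrite -(l2norm_sqr u) expr2 mulrCA ler_wpM2l ?l2norm_ge0//.
exact: l2norm_mulmx_le.
Qed.

Lemma diag_mx_col {R : realType} {n : nat} (D : 'rV[R]_n) (w : 'cV[R]_n) :
  diag_mx D *m w = \col_i (D 0 i * w i 0).
Proof. by apply/colP => i; rewrite mul_diag_mx !mxE. Qed.

(** The matrices in the definitions of Lhat and Ltilde are D (sum of P_j A A^T
    P_j) D with D the square root of Lambda. Their quadratic form at D^-1 w is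
    the left-hand side, and the squared norm of D^-1 w is the sum on the
    right. *)
Lemma gram_form_le {R : realType} {n d m : nat} (L : 'I_n -> R)
    (P : 'I_m -> 'M[R]_n) (A : 'M[R]_(n, d)) (w : 'cV[R]_n) :
  (forall i, 0 < L i) -> (forall j, (P j)^T = P j) ->
  \sum_(j < m) dotv (A^T *m (P j *m w)) (A^T *m (P j *m w)) <=
  opnorm (sqrt_Lambda L *m (\sum_(j < m) (P j *m A *m A^T *m P j)) *m
          sqrt_Lambda L) * \sum_i w i 0 ^+ 2 / L i.
Proof.
move=> L0 PT; set D := sqrt_Lambda _.
pose u : 'cV[R]_n := \col_i (w i 0 / Num.sqrt (L i)).
have sL i : Num.sqrt (L i) != 0 by rewrite gt_eqF// sqrtr_gt0.
have -> : w = D *m u.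
  apply/colP => i; rewrite /D /sqrt_Lambda diag_mx_col !mxE mulrC divfK//.
have -> : \sum_i (D *m u) i 0 ^+ 2 / L i = dotv u u.
  rewrite dotvE; apply: eq_bigr => i _.
  rewrite /D /sqrt_Lambda diag_mx_col !mxE mulrC -[in (L i)^-1](sqr_sqrtr (ltW (L0 i))).
  by field.
apply: le_trans (quadratic_form_le_opnorm _ _).
have DT : D^T = D by rewrite /D /sqrt_Lambda tr_diag_mx.
rewrite -!mulmxA [leRHS]dotv_mulmx DT mulmx_suml dotv_sumr.
apply: ler_sum => j _.
by rewrite -!mulmxA [leRHS]dotv_mulmx PT [leRHS]dotv_mulmx.
Qed.

(** * Fenchel duality and proximal steps *)

Lemma conjugate_ge {R : realType} (g : R -> R) (x y : R) :
  ((y * x - g x)%:E <= Defs.conjugate g y)%E.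
Proof. by apply: ereal_sup_ubound; exists x. Qed.

(** The Fenchel inequality is an equality at the derivative. *)
Lemma conjugate_derive {R : realType} {L : R} {g : R -> R} (u : R) :
  convex_function [set: R^o] g -> smooth L g ->
  Defs.conjugate g (derive1 g u) = (derive1 g u * u - g u)%:E.
Proof.
move=> cg sg; apply/eqP; rewrite eq_le conjugate_ge andbT.
apply: ge_ereal_sup => _ [x _ <-]; rewrite lee_fin.
by have := convex_smooth_tangent u x cg sg; lra.
Qed.

Lemma argmax_unique {T : zmodType} {disp : Order.disp_t} {S : porderType disp}
    (F : T -> S) (x : T) :
  (forall z, (F z <= F x)%O) -> (forall y, (F x <= F y)%O -> y = x) ->
  argmax F = x.
Proof. by move=> Fx ux; apply: xget_unique => //= y Fy; exact: ux. Qed.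

Lemma argmin_unique {T : zmodType} {disp : Order.disp_t} {S : porderType disp}
    (F : T -> S) (x : T) :
  (forall z, (F x <= F z)%O) -> (forall y, (F y <= F x)%O -> y = x) ->
  argmin F = x.
Proof. by move=> Fx ux; apply: xget_unique => //= y Fy; exact: ux. Qed.

(** The Fenchel inequality bounds the objective by the sum of the l_j (u_j),
    attained at the derivatives. Conversely, if y attains this value, changing
    one coordinate of the points at which the Fenchel inequalities are applied
    shows that each y_j is a subgradient of l_j at u_j. *)
Lemma argmax_fenchel {R : realType} {b : nat} (l : 'I_b -> R -> R)
    (L : 'I_b -> R) (u : 'cV[R]_b) :
  (forall j, 0 < L j) -> (forall j, convex_function [set: R^o] (l j)) ->
  (forall j, smooth (L j) (l j)) ->
  argmax (fun y : 'cV[R]_b =>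
    ((dotv y u)%:E - \sum_(j < b) Defs.conjugate (l j) (y j ord0))%E) =
  \col_j derive1 (l j) (u j 0).
Proof.
move=> L0 cl sl; set q := \col_j _.
have Fle y (x : 'cV[R]_b) :
    ((dotv y u)%:E - \sum_(j < b) Defs.conjugate (l j) (y j ord0) <=
     (dotv y u - \sum_j (y j 0 * x j 0 - l j (x j 0)))%:E)%E.
  rewrite EFinB leeB// -sumEFin; apply: lee_sum => j _; exact: conjugate_ge.
have Fq : ((dotv q u)%:E - \sum_(j < b) Defs.conjugate (l j) (q j ord0))%E =
    (\sum_j l j (u j 0))%:E.
  under eq_bigr => j _ do rewrite [q j ord0]mxE (conjugate_derive _ (cl j) (sl j)).
  rewrite sumEFin -EFinB dotvE -sumrB; congr EFin; apply: eq_bigr => j _.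
  by rewrite mxE; lra.
apply: argmax_unique => y.
  apply: le_trans (Fle y u) _; rewrite Fq lee_fin dotvE -sumrB.
  by apply: ler_sum => j _; lra.
rewrite Fq => h; apply/colP => i; rewrite mxE.
apply: (subgradient_eq_derive _ _ (L0 i) (sl i)) => x.
(* Move only the i-th point: the other terms cancel. *)
have := le_trans h (Fle y (\col_j (if j == i then x else u j 0))).
rewrite lee_fin dotvE -sumrB (bigD1 i)//= [leRHS](bigD1 i)//= !mxE eqxx.
rewrite [X in _ <= _ + X](eq_bigr (fun j => l j (u j 0))); last first.
  by move=> j /negPf ji; rewrite !mxE ji; lra.
by rewrite lerD2r; lra.
Qed.

Lemma dual_optE {R : realType} {n d : nat} (a : 'I_n -> 'cV[R]_d)
    (l : 'I_n -> R -> R) (L : 'I_n -> R) (x : 'cV[R]_d) :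
  (forall j, 0 < L j) -> (forall j, convex_function [set: R^o] (l j)) ->
  (forall j, smooth (L j) (l j)) ->
  dual_opt a l x = \col_i derive1 (l i) (dotv (a i) x).
Proof.
move=> L0 cl sl; apply/colP => i; rewrite !mxE.
set u := dotv _ _.
apply: argmax_unique => y; rewrite (conjugate_derive _ (cl i) (sl i)) -EFinB;
  set q : R := derive1 (l i) u.
  apply: (@le_trans _ _ ((y * u)%:E - (y * u - l i u)%:E)%E).
    by rewrite leeB// conjugate_ge.
  by rewrite -EFinB lee_fin; lra.
move=> h; apply: (subgradient_eq_derive _ _ (L0 i) (sl i)) => x'.
have : ((q * u - (q * u - l i u))%:E <= (y * u)%:E - (y * x' - l i x')%:E)%E.
  by apply: le_trans h _; rewrite leeB// conjugate_ge.
by rewrite -EFinB lee_fin; lra.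
Qed.

(** Completing the square: the value at z exceeds the value at the claimed
    minimizer by c / 2 times the squared distance between them. *)
Lemma argmin_prox {R : realType} {b d : nat} (c : R) (B : 'M[R]_(b, d))
    (y : 'cV[R]_b) (x : 'cV[R]_d) :
  0 < c ->
  argmin (fun z : 'cV[R]_d => dotv y (B *m z) + c / 2 * l2norm (z - x) ^+ 2) =
  x - c^-1 *: (B^T *m y).
Proof.
move=> c0; set G := B^T *m y; set xn := x - _.
have key z : dotv y (B *m z) + c / 2 * l2norm (z - x) ^+ 2 =
    dotv y (B *m xn) + c / 2 * l2norm (xn - x) ^+ 2 + c / 2 * dotv (z - xn) (z - xn).
  have -> : xn - x = - (c^-1 *: G) by rewrite /xn addrAC subrr add0r.
  have -> : z - x = (z - xn) - c^-1 *: G by rewrite /xn opprB addrA addrAC addrK.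
  have -> : dotv y (B *m z) = dotv y (B *m xn) + dotv G (z - xn).
    by rewrite !dotv_mulmx -/G -dotvDr (addrC xn) subrK.
  move: (z - xn) => h.
  rewrite !l2norm_sqr dotvNl dotvNr dotvBl !dotvBr !dotvZl !dotvZr (dotvC h G).
  by field; lra.
apply: argmin_unique => z.
  by rewrite (key z) lerDl mulr_ge0 ?dotv_ge0// ltW// divr_gt0.
rewrite (key z) gerDl pmulr_rle0 ?divr_gt0// => /dotv_eq0 /eqP.
by rewrite subr_eq0 => /eqP.
Qed.

(** * The iterates of an epoch *)

Lemma sum_block_idx {V : nmodType} {n b m : nat} (nbm : n = (b * m)%N)
    (i : 'I_m) (F : 'I_n -> V) :
  (0 < b)%N ->
  \sum_(j < b) F (block_idx nbm i j) =
  \sum_(p < n | (b * i <= p < b * i.+1)%N) F p.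
Proof.
move=> b0.
rewrite (reindex_onto (block_idx nbm i)
  (fun p : 'I_n => insubd (Ordinal b0) (p - b * i)%N))/=.
  apply: eq_bigl => j; rewrite leq_addr mulnS addnC ltn_add2r ltn_ord/=.
  by rewrite addnK valKd eqxx.
move=> p /andP[ip pi]; apply: val_inj => /=.
by rewrite val_insubd ltn_subLR// -mulnSr pi subnKC.
Qed.

Lemma mul_trmx_batch {R : realType} {n d b m : nat} (nbm : n = (b * m)%N)
    (a : 'I_n -> 'cV[R]_d) (s : 'S_n) (i : 'I_m) (h : 'cV[R]_n) :
  (0 < b)%N ->
  (batch_mx nbm a s i)^T *m (\col_j h (block_idx nbm i j) 0) =
  (data_mx (a \o s))^T *m (I_block R n b i *m h).
Proof.
move=> b0; apply/colP => k; rewrite !mxE.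
under eq_bigr => j _ do rewrite !mxE.
rewrite (sum_block_idx nbm i (fun p => a (s p) k 0 * h p 0) b0) big_mkcond.
apply: eq_bigr => p _; rewrite /I_block diag_mx_col !mxE.
by case: ifP => _; rewrite ?mul1r// mul0r mulr0.
Qed.

(** The dual-then-primal step is a gradient step on one mini-batch. Writing
    the batch through I_block keeps all the blocks inside one n-dimensional
    space. *)
Lemma primal_stepE {R : realType} {n d b m : nat} (nbm : n = (b * m)%N)
    (a : 'I_n -> 'cV[R]_d) (l : 'I_n -> R -> R) (L : 'I_n -> R) (s : 'S_n)
    (eta : R) (i : 'I_m) (x : 'cV[R]_d) :
  (0 < b)%N -> 0 < eta ->
  (forall j, 0 < L j) -> (forall j, convex_function [set: R^o] (l j)) ->
  (forall j, smooth (L j) (l j)) ->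
  primal_step nbm a l s eta i x =
  x - (eta / b%:R) *: ((data_mx (a \o s))^T *m (I_block R n b i *m
        \col_p derive1 (l (s p)) (dotv (a (s p)) x))).
Proof.
move=> b0 eta0 L0 cl sl; have b0R : 0 < b%:R :> R by rewrite ltr0n.
rewrite -(mul_trmx_batch nbm)// -(invf_div b%:R eta).
rewrite -(argmin_prox _ _ _ _ (divr_gt0 b0R eta0)) /primal_step.
have -> : dual_step nbm a l s i x = \col_j (\col_p derive1 (l (s p))
    (dotv (a (s p)) x)) (block_idx nbm i j) ord0.
  rewrite /dual_step (argmax_fenchel (fun j => l (s (block_idx nbm i j)))
    (fun j => L (s (block_idx nbm i j))))//.
  apply/colP => j; rewrite !mxE; congr (derive1 _ _).
  by rewrite dotvE; apply: eq_bigr => k _; rewrite !mxE.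
suff -> : b%:R / (2 * eta) = b%:R / eta / 2 :> R by [].
by field; rewrite gt_eqF.
Qed.

(** The vector of derivatives is written once for the whole epoch, position p
    being evaluated at the iterate of index p %/ b: the block I_block i then
    selects the derivatives at the iterate z i. *)
Lemma epoch_iterates {R : realType} {n d b m : nat} (nbm : n = (b * m)%N)
    (a : 'I_n -> 'cV[R]_d) (l : 'I_n -> R -> R) (L : 'I_n -> R) (s : 'S_n)
    (eta : R) (x : 'cV[R]_d) :
  (0 < b)%N -> 0 < eta ->
  (forall j, 0 < L j) -> (forall j, convex_function [set: R^o] (l j)) ->
  (forall j, smooth (L j) (l j)) ->
  exists z : nat -> 'cV[R]_d,
    [/\ z 0%N = x, z m = epoch nbm a l s eta x &
     forall i, (i < m)%N ->
       z i.+1 = z i - (eta / b%:R) *: ((data_mx (a \o s))^T *m (I_block R n b i *m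
        \col_p derive1 (l (s p)) (dotv (a (s p)) (z (p %/ b)%N))))].
Proof.
move=> b0 eta0 L0 cl sl.
pose step := fun (z : 'cV[R]_d) (i : 'I_m) => primal_step nbm a l s eta i z.
exists (fun t => foldl step x (take t (enum 'I_m))); split.
- by rewrite take0.
- by rewrite /epoch take_oversize// size_enum_ord.
move=> i im; pose o := Ordinal im.
rewrite (take_nth o) ?size_enum_ord// (nth_ord_enum o o) foldl_rcons.
set y := foldl _ _ _.
have -> : step y o = _ := primal_stepE nbm a l L s eta o y b0 eta0 L0 cl sl.
suff -> : I_block R n b o *m \col_p derive1 (l (s p)) (dotv (a (s p)) y) =
    I_block R n b i *m \col_p derive1 (l (s p))
      (dotv (a (s p)) (foldl step x (take (p %/ b) (enum 'I_m)))) by [].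
rewrite /I_block !diag_mx_col; apply/colP => p; rewrite !mxE/=.
case: (boolP (b * i <= p < b * i.+1)%N) => [/andP[ip pi]|_]; last by rewrite !mul0r.
have -> // : (p %/ b = i)%N.
apply/eqP; rewrite eqn_leq -ltnS ltn_divLR// leq_divRL//.
by rewrite mulnC pi mulnC ip.
Qed.

Lemma I_from0 {R : realType} {n : nat} : I_from R n 0 = 1%:M.
Proof. by apply/matrixP => i j; rewrite !mxE. Qed.

Lemma I_from_split {R : realType} {n : nat} (b t : nat) :
  I_from R n (b * t) = I_block R n b t + I_from R n (b * t.+1).
Proof.
rewrite /I_from /I_block -raddfD/=; congr diag_mx; apply/rowP => p; rewrite !mxE.
rewrite -natrD; congr (_%:R).
case: (ltnP p (b * t.+1)) => h; rewrite ?andbT ?addn0 ?andbF//.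
by rewrite (leq_trans _ h)// leq_mul2l leqnSn orbT.
Qed.

Lemma I_from_full {R : realType} {n : nat} : I_from R n n = 0.
Proof.
by apply/matrixP => i j; rewrite !mxE leqNgt ltn_ord/= mul0rn.
Qed.

(** Young's inequality with weight t on each product. For t = 0 the hypothesis
    forces every p i to vanish, which covers the case where Ltilde is zero. *)
Lemma sum_dotv_young {R : realType} {I : finType} {d : nat}
    (p q : I -> 'cV[R]_d) (t U : R) :
  0 <= t -> 0 <= U -> \sum_i dotv (p i) (p i) <= t * U ->
  \sum_i dotv (p i) (q i) <= U / 2 + t / 2 * \sum_i dotv (q i) (q i).
Proof.
move=> t0 U0 h; have [t1|t1] := ltP 0 t.
  have : \sum_i 2 * t * dotv (p i) (q i) <=
         \sum_i (dotv (p i) (p i) + t ^+ 2 * dotv (q i) (q i)).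
    apply: ler_sum => i _; have := dotv_young (p i) (t *: q i).
    by rewrite !dotvZr dotvZl; lra.
  rewrite big_split/= -!mulr_sumr.
  set P := \sum_i _ in h *; set Q := \sum_i dotv (q i) _; set S := \sum_i _ => h2.
  suff : 0 <= 2 * t * (U / 2 + t / 2 * Q - S) by rewrite pmulr_rge0 ?subr_ge0; lra.
  lra.
have {}t1 : t = 0 by apply/eqP; rewrite eq_le t0 t1.
rewrite t1 mul0r in h *.
rewrite big1 ?mul0r; first by lra.
move=> i _; have -> : p i = 0.
  apply: dotv_eq0; apply: le_trans _ h.
  by rewrite (bigD1 i)//= lerDl sumr_ge0// => j _; exact: dotv_ge0.
by rewrite /dotv trmx0 mul0mx mxE.
Qed.

(** * Descent over an epoch *)

Lemma wsq_ge0 {R : realType} {n : nat} (L : 'I_n -> R) (w : 'cV[R]_n) :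
  (forall i, 0 < L i) -> 0 <= \sum_i w i 0 ^+ 2 / L i.
Proof. by move=> L0; apply: sumr_ge0 => i _; rewrite divr_ge0 ?sqr_ge0// ltW. Qed.

Lemma data_mx_mulE {R : realType} {n d : nat} (a : 'I_n -> 'cV[R]_d) x p :
  (data_mx a *m x) p 0 = dotv (a p) x.
Proof. by rewrite dotvE mxE; apply: eq_bigr => k _; rewrite mxE. Qed.

Lemma data_mx_tr_mulE {R : realType} {n d : nat} (a : 'I_n -> 'cV[R]_d) w :
  (data_mx a)^T *m w = \sum_p w p 0 *: a p.
Proof.
apply/colP => k; rewrite mxE summxE; apply: eq_bigr => p _.
by rewrite !mxE mulrC.
Qed.

(** Regroups a sum over blocks as a sum over positions: each position p lies
    in the single block p %/ b. *)
Lemma sum_blocks_dotv {R : realType} {n d b m : nat} (nbm : n = (b * m)%N)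
    (A : 'M[R]_(n, d)) (h : 'cV[R]_n) (w : nat -> 'cV[R]_d) :
  (0 < b)%N ->
  \sum_(i < m) dotv (A^T *m (I_block R n b i *m h)) (w i) =
  \sum_p h p 0 * (A *m w (p %/ b)%N) p 0.
Proof.
move=> b0.
under eq_bigr => i _ do rewrite -dotv_mulmx dotvE.
rewrite exchange_big/=; apply: eq_bigr => p _.
have pm : (p %/ b < m)%N by rewrite ltn_divLR// mulnC -nbm.
have pb : (b * (p %/ b) <= p < b * (p %/ b).+1)%N.
  by rewrite mulnC leq_trunc_div/= mulnC -ltn_divLR.
rewrite (bigD1 (Ordinal pm))//= big1 ?addr0.
  by rewrite /I_block diag_mx_col !mxE pb mul1r.
move=> i ip; rewrite /I_block diag_mx_col !mxE.
case: (boolP (b * i <= p < b * i.+1)%N) => [/andP[bi ib]|_]; last by rewrite !mul0r.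
case/eqP: ip; apply: val_inj => /=; apply/eqP.
by rewrite eqn_leq leq_divRL// mulnC bi -ltnS ltn_divLR// mulnC ib.
Qed.

Lemma dotv_sqr_split {R : realType} {d : nat} (u v : 'cV[R]_d) :
  dotv u u <= 2 * dotv (u - v) (u - v) + 2 * dotv v v.
Proof.
have -> : dotv u u = dotv (u - v + v) (u - v + v) by rewrite subrK.
have := dotv_young (u - v) v; move: (u - v) => e.
by rewrite dotvDl !dotvDr (dotvC v); lra.
Qed.

(** Here Lh and Lt are any constants for which the two Gram inequalities hold;
    in the algorithm they are Lhat and Ltilde. The tails of the sum of the y_p a_p are left in the
    conclusion, so that they can be bounded in two ways. *)
Lemma epoch_descent {R : realType} {n d b m : nat} (nbm : n = (b * m)%N)
    (a : 'I_n -> 'cV[R]_d) (l : 'I_n -> R -> R) (L : 'I_n -> R)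
    (z : nat -> 'cV[R]_d) (eta Lh Lt : R) (xs : 'cV[R]_d) :
  let A := data_mx a in
  let g : 'cV[R]_n := \col_p derive1 (l p) (dotv (a p) (z (p %/ b)%N)) in
  let y : 'cV[R]_n := \col_p derive1 (l p) (dotv (a p) xs) in
  let tail w i := A^T *m (I_from R n (b * i) *m w) in
  (0 < b)%N -> 0 < eta ->
  (forall j, 0 < L j) -> (forall j, convex_function [set: R^o] (l j)) ->
  (forall j, smooth (L j) (l j)) ->
  (forall i, (i < m)%N ->
    z i.+1 = z i - (eta / b%:R) *: (A^T *m (I_block R n b i *m g))) ->
  0 <= Lt ->
  (forall w : 'cV[R]_n, \sum_(i < m) dotv (tail w i) (tail w i) <=
    m%:R * n%:R * Lh * \sum_p w p 0 ^+ 2 / L p) ->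
  (forall w : 'cV[R]_n, \sum_(i < m) dotv (A^T *m (I_block R n b i *m w))
                                (A^T *m (I_block R n b i *m w)) <=
    b%:R * Lt * \sum_p w p 0 ^+ 2 / L p) ->
  2 * eta ^+ 2 * n%:R ^+ 2 * (Lh * Lt) <= b%:R ^+ 2 ->
  eta * \sum_p (l p (dotv (a p) (z m)) - l p (dotv (a p) xs)) <=
  b%:R / 2 * (dotv (z 0%N - xs) (z 0%N - xs) - dotv (z m - xs) (z m - xs)) +
  eta ^+ 3 * Lt / b%:R * \sum_(i < m) dotv (tail y i) (tail y i).
Proof.
move=> A g y tail b0 eta0 L0 cl sl zS Lt0 hLh hLt step.
have b0R : 0 < b%:R :> R by rewrite ltr0n.
have b1R : b%:R != 0 :> R by rewrite gt_eqF.
pose v : 'cV[R]_n := \col_p derive1 (l p) (dotv (a p) (z m)).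
(* The displacement up to block t uses the positions before b t, that is all
   but the tail. *)
have zE t : (t <= m)%N ->
    z t = z 0%N - (eta / b%:R) *: (A^T *m g - tail g t).
  elim: t => [_|t IH tm].
    by rewrite /tail muln0 I_from0 mul1mx subrr scaler0 subr0.
  rewrite zS// IH ?(ltnW tm)// -addrA -opprD -scalerDr; congr (_ - _ *: _).
  rewrite /tail I_from_split mulmxDl mulmxDr opprD.
  by rewrite -addrA; congr (_ + _); rewrite addrAC addNr add0r.
have tail_m w : tail w m = 0 by rewrite /tail -nbm I_from_full mul0mx mulmx0.
have zm_sub t : (t <= m)%N -> z m - z t = - (eta / b%:R) *: tail g t.
  move=> tm; rewrite (zE m)// (zE t tm) tail_m subr0 opprB addrC addrA subrK.
  by rewrite -scalerBr addrAC subrr add0r scalerN scaleNr.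
have zm_sub0 : A^T *m g = (b%:R / eta) *: (z 0%N - z m).
  rewrite (zE m)// tail_m subr0 opprB addrC subrK scalerA.
  by rewrite mulrA divfK ?gt_eqF// divff// scale1r.
(* Co-coercivity from z_m to the evaluation point, then from there to xs. *)
have per_p p : l p (dotv (a p) (z m)) - l p (dotv (a p) xs) <=
    g p 0 * (A *m (z m - xs)) p 0
    + (v - g) p 0 * (A *m (z m - z (p %/ b)%N)) p 0
    - (v - g) p 0 ^+ 2 / L p / 2 - (g - y) p 0 ^+ 2 / L p / 2.
  rewrite /A !data_mx_mulE !dotvBr !mxE.
  have := convex_smooth_cocoercive (dotv (a p) (z m)) (dotv (a p) (z (p %/ b)%N))
    (L0 p) (cl p) (sl p).
  have := convex_smooth_cocoercive (dotv (a p) (z (p %/ b)%N)) (dotv (a p) xs)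
    (L0 p) (cl p) (sl p).
  move: (derive1 _ _) (derive1 _ _) (derive1 _ _) (l p _) (l p _) (l p _).
  clear nbm; rewrite !invfM => dw dxs du lw lxs lu; lra.
have nR : n%:R = b%:R * m%:R :> R by rewrite -natrM -nbm.
have sum_cross := sum_blocks_dotv nbm A (v - g) (fun t => z m - z t) b0.
clear nbm.
set U := \sum_p (v - g) p 0 ^+ 2 / L p.
set W := \sum_p (g - y) p 0 ^+ 2 / L p.
set E := \sum_(i < m) dotv (tail y i) (tail y i).
pose G := \sum_(i < m) dotv (tail g i) (tail g i).
pose X := dotv (z 0%N - z m) (z m - xs).
have W0 : 0 <= W by exact: wsq_ge0.
have U0 : 0 <= U by exact: wsq_ge0.
have young := sum_dotv_young _ (fun i : 'I_m => z m - z i) _ _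
  (mulr_ge0 (ltW b0R) Lt0) U0 (hLt (v - g)).
have QE : \sum_(i < m) dotv (z m - z i) (z m - z i) = (eta / b%:R) ^+ 2 * G.
  rewrite /G mulr_sumr; apply: eq_bigr => i _.
  by rewrite zm_sub ?(ltnW (ltn_ord i))// dotvZl dotvZr; ring.
(* Splitting g as (g - y) + y: Lh sees only the first part. *)
have GE : G <= 2 * (m%:R * n%:R * Lh * W) + 2 * E.
  apply: (@le_trans _ _ (\sum_(i < m) (2 * dotv (tail (g - y) i) (tail (g - y) i)
      + 2 * dotv (tail y i) (tail y i)))).
    apply: ler_sum => i _; have -> : tail (g - y) i = tail g i - tail y i.
      by rewrite /tail !mulmxBr.
    exact: dotv_sqr_split.
  by rewrite big_split/= -!mulr_sumr lerD2r ler_pM2l.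
(* The three-point identity; the last square is dropped in the end. *)
have XE : 2 * X = dotv (z 0%N - xs) (z 0%N - xs) - dotv (z m - xs) (z m - xs)
    - dotv (z 0%N - z m) (z 0%N - z m).
  have -> : z 0%N - xs = (z 0%N - z m) + (z m - xs) by rewrite addrA subrK.
  rewrite /X; move: (z 0%N - z m) (z m - xs) => e f.
  by rewrite dotvDl !dotvDr (dotvC f); lra.
have D0 := dotv_ge0 (z 0%N - z m).
have sum_le : \sum_p (l p (dotv (a p) (z m)) - l p (dotv (a p) xs)) <=
    b%:R / eta * X + U / 2 + b%:R * Lt / 2 * ((eta / b%:R) ^+ 2 * G) - U / 2 - W / 2.
  apply: le_trans; first by apply: ler_sum => p _; exact: per_p.
  rewrite !sumrB big_split/= -!mulr_suml -/U -/W -sum_cross.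
  rewrite !lerD2r -[X in _ <= X]addrA; apply: lerD; last by rewrite -QE.
  by rewrite -dotvZl -zm_sub0 -dotv_mulmx dotvE.
apply: (@le_trans _ _ (eta * (b%:R / eta * X
    + b%:R * Lt / 2 * ((eta / b%:R) ^+ 2 * (2 * (m%:R * n%:R * Lh * W) + 2 * E)) - W / 2))).
  rewrite ler_pM2l//; apply: le_trans sum_le _.
  have : b%:R * Lt / 2 * ((eta / b%:R) ^+ 2 * G) <= b%:R * Lt / 2 *
      ((eta / b%:R) ^+ 2 * (2 * (m%:R * n%:R * Lh * W) + 2 * E)).
    by rewrite ler_wpM2l ?divr_ge0 ?mulr_ge0 ?(ltW b0R)// ler_wpM2l ?sqr_ge0.
  lra.
have -> : eta * (b%:R / eta * X
    + b%:R * Lt / 2 * ((eta / b%:R) ^+ 2 * (2 * (m%:R * n%:R * Lh * W) + 2 * E)) - W / 2)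
  = b%:R * X + eta ^+ 3 * Lt / b%:R * E
    + eta * W * (2 * eta ^+ 2 * n%:R ^+ 2 * (Lh * Lt) / b%:R ^+ 2 - 1) / 2.
  rewrite nR; field; rewrite b1R gt_eqF//.
(* The step size condition makes the factor of W nonpositive. *)
have step1 : 2 * eta ^+ 2 * n%:R ^+ 2 * (Lh * Lt) / b%:R ^+ 2 <= 1.
  by rewrite ler_pdivrMr ?mul1r// exprn_gt0.
have : eta * W * (2 * eta ^+ 2 * n%:R ^+ 2 * (Lh * Lt) / b%:R ^+ 2 - 1) <= 0.
  apply: mulr_ge0_le0; first exact: (mulr_ge0 (ltW eta0) W0).
  by rewrite subr_le0.
have bX : b%:R * X <= b%:R / 2 *
    (dotv (z 0%N - xs) (z 0%N - xs) - dotv (z m - xs) (z m - xs)).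
  rewrite -mulrA ler_pM2l//; lra.
move: bX; set bX := b%:R * X; set bD := b%:R / 2 * _; set T := eta * W * _; set Z := _ * E.
lra.
Qed.

(** * Stationarity, error terms and averaging *)

Lemma objective_perm {R : realType} {n d : nat} (a : 'I_n -> 'cV[R]_d)
    (l : 'I_n -> R -> R) (s : 'S_n) x :
  objective a l x = n%:R^-1 * \sum_p l (s p) (dotv (a (s p)) x).
Proof. by rewrite /objective (reindex_perm s). Qed.

(** A step of length t along minus the gradient S of the sum of the losses
    decreases this sum by t |S|^2 up to an error of order t^2, so S = 0 at a
    minimizer. *)
Lemma stationary {R : realType} {n d : nat} (a : 'I_n -> 'cV[R]_d)
    (l : 'I_n -> R -> R) (L : 'I_n -> R) (xs : 'cV[R]_d) :
  (forall i, smooth (L i) (l i)) ->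
  (forall x, objective a l xs <= objective a l x) ->
  \sum_i derive1 (l i) (dotv (a i) xs) *: a i = 0.
Proof.
move=> sl xmin; set S := \sum_i _.
have [n0|n0] := posnP n.
  by rewrite /S big1// => i; have := ltn_ord i; rewrite [X in (_ < X)%N]n0.
have n0R : 0 < n%:R^-1 :> R by rewrite invr_gt0 ltr0n.
apply: dotv_eq0.
apply: (@le0_of_le_small _ _ (\sum_i L i / 2 * dotv (a i) S ^+ 2)) => t t0 t1.
have := xmin (xs - t *: S); rewrite /objective ler_pM2l// => h.
have : \sum_i l i (dotv (a i) xs) <= \sum_i (l i (dotv (a i) xs)
    - t * (derive1 (l i) (dotv (a i) xs) * dotv (a i) S)
    + t ^+ 2 * (L i / 2 * dotv (a i) S ^+ 2)).
  apply: le_trans h _; apply: ler_sum => i _.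
  have := smooth_le_quadratic (dotv (a i) xs) (dotv (a i) (xs - t *: S)) (sl i).
  by rewrite dotvBr dotvZr; lra.
rewrite big_split sumrB/= -!mulr_sumr.
have -> : \sum_i derive1 (l i) (dotv (a i) xs) * dotv (a i) S = dotv S S.
  by rewrite {3}/S dotv_suml; apply: eq_bigr => i _; rewrite dotvZl.
set Q := \sum_i (L i / 2 * _); set F := \sum_i l i _ => h2.
suff : 0 <= t * (t * Q - dotv S S) by rewrite pmulr_rge0// subr_ge0.
lra.
Qed.

(** The tail at i = 0 is the full sum, which is zero. Each of the m - 1 = (n -
    b) / b others has at most n - b terms, hence a squared norm of at most n -
    b times the sum of the squared norms of all the terms. *)
Lemma sum_tails_le {R : realType} {n d b m : nat} (nbm : n = (b * m)%N)
    (a : 'I_n -> 'cV[R]_d) (y : 'cV[R]_n) :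
  (0 < b)%N -> (0 < m)%N -> (data_mx a)^T *m y = 0 ->
  \sum_(i < m) dotv ((data_mx a)^T *m (I_from R n (b * i) *m y))
                    ((data_mx a)^T *m (I_from R n (b * i) *m y)) <=
  (n%:R - b%:R) ^+ 2 / b%:R * \sum_p y p 0 ^+ 2 * l2norm (a p) ^+ 2.
Proof.
move=> b0 m0 Ay0; set T := \sum_p y p 0 ^+ 2 * _.
have b0R : 0 < b%:R :> R by rewrite ltr0n.
have T0 : 0 <= T by apply: sumr_ge0 => p _; rewrite mulr_ge0 ?sqr_ge0.
case: m m0 nbm => // m' _ nbm.
have nb : n%:R - b%:R = b%:R * m'%:R :> R.
  by rewrite nbm mulnS natrD addrC addKr natrM.
rewrite big_ord_recl muln0 I_from0 mul1mx Ay0 {1}/dotv mulmx0 mxE add0r.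
apply: (@le_trans _ _ (\sum_(i < m') (n%:R - b%:R) * T)); last first.
  rewrite sumr_const card_ord -[_ *+ m']mulr_natr nb le_eqVlt; apply/orP; left; apply/eqP.
  by clear nbm; field; rewrite gt_eqF.
apply: ler_sum => i _; set k := (b * _)%N.
have bk : (b <= k)%N by rewrite /k leq_pmulr.
have -> : (data_mx a)^T *m (I_from R n k *m y) =
    \sum_(p < n | (k <= p)%N) y p 0 *: a p.
  rewrite data_mx_tr_mulE [RHS]big_mkcond; apply: eq_bigr => p _.
  rewrite /I_from diag_mx_col !mxE; case: leqP => _; rewrite ?mul1r// mul0r.
  by rewrite scale0r.
apply: le_trans (dotv_sum_le _ _) _; apply: ler_pM => //.
- by apply: sumr_ge0 => p _; exact: dotv_ge0.
- rewrite lerBrDr -natrD ler_nat.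
  set P := fun p : 'I_n => (k <= p)%N.
  apply: (@leq_trans (#|P| + #|[predC P]|)); last by rewrite cardC card_ord.
  rewrite leq_add2l.
  have bn : (b <= n)%N by rewrite nbm leq_pmulr.
  rewrite -[leqLHS]card_ord -(@card_codom _ _ (widen_ord bn)); last first.
    by move=> u v /(congr1 val)/= /val_inj.
  apply: subset_leq_card; apply/fintype.subsetP => p /codomP[u ->].
  by rewrite !inE/= /P/= -ltnNge (leq_trans (ltn_ord u)).
- rewrite /T [leRHS](bigID (fun p : 'I_n => (k <= p)%N))/=.
  apply: le_trans (_ : \sum_(p < n | (k <= p)%N) y p 0 ^+ 2 * l2norm (a p) ^+ 2 <= _).
    by apply: ler_sum => p _; rewrite dotvZl dotvZr l2norm_sqr expr2 mulrA.
  by rewrite lerDl sumr_ge0// => p _; rewrite mulr_ge0 ?sqr_ge0.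
Qed.

Lemma wnorm_invLambda_sqr {R : realType} {n : nat} (L : 'I_n -> R)
    (y : 'cV[R]_n) :
  (forall i, 0 < L i) ->
  wnorm (invmx (Lambda L)) y ^+ 2 = \sum_i y i 0 ^+ 2 / L i.
Proof.
move=> L0.
have dLK : Lambda L *m diag_mx (\row_i (L i)^-1) = 1%:M.
  apply/matrixP => i j; rewrite /Lambda mulmx_diag !mxE.
  by have [->|] := eqVneq i j; rewrite ?mulr1n ?mulr0n// mulfV// gt_eqF.
have [uL _] := mulmx1_unit dLK.
have -> : invmx (Lambda L) = diag_mx (\row_i (L i)^-1).
  by rewrite -[LHS]mulmx1 -dLK mulKmx.
have E : dotv y (diag_mx (\row_i (L i)^-1) *m y) = \sum_i y i 0 ^+ 2 / L i.
  rewrite dotvE; apply: eq_bigr => i _; rewrite diag_mx_col !mxE.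
  by rewrite expr2 -mulrA; congr (_ * _); rewrite mulrC.
by rewrite /wnorm E sqr_sqrtr// wsq_ge0.
Qed.

(** Jensen's inequality through the tangent of each loss at the average: the
    linear parts cancel in the weighted sum. *)
Lemma objective_jensen {R : realType} {n d : nat} (a : 'I_n -> 'cV[R]_d)
    (l : 'I_n -> R -> R) (L : 'I_n -> R) (r : seq nat) (eta : nat -> R)
    (x : nat -> 'cV[R]_d) :
  (forall i, convex_function [set: R^o] (l i)) ->
  (forall i, smooth (L i) (l i)) ->
  (forall k, k \in r -> 0 <= eta k) -> 0 < \sum_(k <- r) eta k ->
  (\sum_(k <- r) eta k) *
    objective a l ((\sum_(k <- r) eta k)^-1 *: \sum_(k <- r) eta k *: x k) <=
  \sum_(k <- r) eta k * objective a l (x k).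
Proof.
move=> cl sl eta0; set H := \sum_(k <- r) eta k => H0; set xh := _ *: _.
have HE : H *: xh = \sum_(k <- r) eta k *: x k.
  by rewrite scalerA divff ?gt_eqF// scale1r.
rewrite /objective.
rewrite [leRHS](eq_bigr (fun k => n%:R^-1 *
    \sum_i eta k * l i (dotv (a i) (x k)))); last first.
  by move=> k _; rewrite mulrCA mulr_sumr.
rewrite -mulr_sumr mulrCA ler_wpM2l ?invr_ge0// exchange_big mulr_sumr/=.
apply: ler_sum => i _.
pose q := derive1 (l i) (dotv (a i) xh).
have -> : H * l i (dotv (a i) xh) = \sum_(k <- r)
    eta k * (l i (dotv (a i) xh) + q * (dotv (a i) (x k) - dotv (a i) xh)).
  under eq_bigr => k _ do rewrite mulrDr mulrCA mulrBr.
  rewrite big_split/= -mulr_suml -mulr_sumr sumrB -mulr_suml -/H.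
  have <- : H * dotv (a i) xh = \sum_(k <- r) eta k * dotv (a i) (x k).
    by rewrite -dotvZr HE dotv_sumr; apply: eq_bigr => k _; rewrite dotvZr.
  by rewrite subrr mulr0 addr0.
rewrite big_seq [leRHS]big_seq; apply: ler_sum => k kr.
by rewrite ler_wpM2l ?eta0//; exact: convex_smooth_tangent (cl i) (sl i).
Qed.

(** * Progress per epoch and the convergence bound *)

Lemma Lhat_ge0 {R : realType} {n d : nat} (b m : nat) (a : 'I_n -> 'cV[R]_d)
  (L : 'I_n -> R) (s : 'S_n) : 0 <= Lhat b m a L s.
Proof. by rewrite mulr_ge0 ?opnorm_ge0// invr_ge0 mulr_ge0. Qed.

Lemma Ltilde_ge0 {R : realType} {n d : nat} (b m : nat) (a : 'I_n -> 'cV[R]_d)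
  (L : 'I_n -> R) (s : 'S_n) : 0 <= Ltilde b m a L s.
Proof. by rewrite mulr_ge0 ?opnorm_ge0// invr_ge0. Qed.

(** epoch_descent at the permuted data, divided by n, with the sum of the
    tails bounded by Lhat on one side and by sum_tails_le on the other. *)
Lemma epoch_progress {R : realType} {n d b m : nat} (nbm : n = (b * m)%N)
    (a : 'I_n -> 'cV[R]_d) (l : 'I_n -> R -> R) (L : 'I_n -> R) (s : 'S_n)
    (eta : R) (x xs : 'cV[R]_d) :
  (0 < b)%N -> (0 < m)%N -> 0 < eta ->
  (forall i, 0 < L i) -> (forall i, convex_function [set: R^o] (l i)) ->
  (forall i, smooth (L i) (l i)) ->
  (forall z, objective a l xs <= objective a l z) ->
  let Lh := Lhat b m a L s in
  let Lt := Ltilde b m a L s in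
  let x' := epoch nbm a l s eta x in
  2 * eta ^+ 2 * n%:R ^+ 2 * (Lh * Lt) <= b%:R ^+ 2 ->
  eta * (objective a l x' - objective a l xs) <=
  b%:R / (2 * n%:R) * (l2norm (x - xs) ^+ 2 - l2norm (x' - xs) ^+ 2) +
  Num.min
    (eta ^+ 3 * n%:R / b%:R ^+ 2 * Lh * Lt *
       wnorm (invmx (Lambda L)) (dual_opt a l xs) ^+ 2)
    (eta ^+ 3 * (n%:R - b%:R) ^+ 2 / b%:R ^+ 2 * Lt * sigma2 a l xs).
Proof.
move=> b0 m0 eta0 L0 cl sl xmin Lh Lt x' step.
have [b0R m0R] : 0 < b%:R :> R /\ 0 < m%:R :> R by rewrite !ltr0n.
have nR : n%:R = b%:R * m%:R :> R by rewrite -natrM -nbm.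
have n0R : 0 < n%:R :> R by rewrite nR mulr_gt0.
have Lt0 : 0 <= Lt by exact: Ltilde_ge0.
have [z [z0 zm zS]] := epoch_iterates nbm a l L s eta x b0 eta0 L0 cl sl.
have hLh (w : 'cV[R]_n) : \sum_(i < m)
    dotv ((data_mx (a \o s))^T *m (I_from R n (b * i) *m w))
         ((data_mx (a \o s))^T *m (I_from R n (b * i) *m w)) <=
    m%:R * n%:R * Lh * \sum_p w p 0 ^+ 2 / (L \o s) p.
  rewrite /Lh /Lhat mulrA mulfV ?mul1r ?gt_eqF ?mulr_gt0//.
  by apply: gram_form_le => [p|j]; rewrite ?L0// /I_from tr_diag_mx.
have hLt (w : 'cV[R]_n) : \sum_(i < m)
    dotv ((data_mx (a \o s))^T *m (I_block R n b i *m w))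
         ((data_mx (a \o s))^T *m (I_block R n b i *m w)) <=
    b%:R * Lt * \sum_p w p 0 ^+ 2 / (L \o s) p.
  rewrite /Lt /Ltilde mulrA mulfV ?mul1r ?gt_eqF//.
  by apply: gram_form_le => [p|j]; rewrite ?L0// /I_block tr_diag_mx.
have := epoch_descent nbm (a \o s) (l \o s) (L \o s) z eta Lh Lt xs b0 eta0
  (fun j => L0 _) (fun j => cl _) (fun j => sl _) zS Lt0 hLh hLt step.
rewrite zm z0 -/x'.
set y : 'cV[R]_n := \col_p _; set E := \sum_(i < m) _ => descent.
have stat : (data_mx (a \o s))^T *m y = 0.
  rewrite data_mx_tr_mulE -[RHS](stationary a l L xs sl xmin) [RHS](reindex_perm s)/=.
  by apply: eq_bigr => p _; rewrite mxE.
have E1 : E <= m%:R * n%:R * Lh * wnorm (invmx (Lambda L)) (dual_opt a l xs) ^+ 2.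
  have -> : wnorm (invmx (Lambda L)) (dual_opt a l xs) ^+ 2 =
      \sum_p y p 0 ^+ 2 / (L \o s) p; last exact: hLh.
    rewrite wnorm_invLambda_sqr// (dual_optE a l L)// (reindex_perm s)/=.
    by apply: eq_bigr => p _; rewrite !mxE.
have E2 : E <= (n%:R - b%:R) ^+ 2 / b%:R * (n%:R * sigma2 a l xs).
  have -> : n%:R * sigma2 a l xs = \sum_p y p 0 ^+ 2 * l2norm ((a \o s) p) ^+ 2.
    rewrite /sigma2 mulrA mulfV ?mul1r ?gt_eqF// (reindex_perm s)/=.
    by apply: eq_bigr => p _; rewrite mxE.
  exact: sum_tails_le.
have scaled : eta * (objective a l x' - objective a l xs) <=
    b%:R / (2 * n%:R) * (l2norm (x - xs) ^+ 2 - l2norm (x' - xs) ^+ 2)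
    + eta ^+ 3 * Lt / (b%:R * n%:R) * E.
  rewrite !(objective_perm a l s) -mulrBr -sumrB mulrCA mulrC ler_pdivrMr//.
  apply: le_trans descent _; rewrite !l2norm_sqr le_eqVlt; apply/orP; left; apply/eqP.
  move: (dotv _ _) (dotv _ _) => u v; field; rewrite !gt_eqF//.
apply: le_trans scaled _; rewrite lerD2l le_min.
have c0 : 0 <= eta ^+ 3 * Lt / (b%:R * n%:R).
  apply: divr_ge0; last by rewrite mulr_ge0.
  by apply: mulr_ge0 => //; rewrite exprn_ge0// ltW.
apply/andP; split.
  apply: le_trans (ler_wpM2l c0 E1) _; apply: eq_ler.
  by rewrite nR; field; rewrite !gt_eqF.
apply: le_trans (ler_wpM2l c0 E2) _; apply: eq_ler.
by field; rewrite !gt_eqF.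
Qed.

Lemma sgd_bound {R : realType} {n d b m : nat} (nbm : n = (b * m)%N)
    (a : 'I_n -> 'cV[R]_d) (l : 'I_n -> R -> R) (L : 'I_n -> R) (s : 'S_n)
    (x0 xs : 'cV[R]_d) (K : nat) (eta : nat -> R) :
  (0 < b)%N -> (0 < m)%N -> (0 < K)%N ->
  (forall i, 0 < L i) -> (forall i, convex_function [set: R^o] (l i)) ->
  (forall i, smooth (L i) (l i)) ->
  (forall z, objective a l xs <= objective a l z) ->
  let f := objective a l in
  let Lh := Lhat b m a L s in
  let Lt := Ltilde b m a L s in
  (forall k, (1 <= k <= K)%N -> 0 < eta k /\
     2 * eta k ^+ 2 * n%:R ^+ 2 * (Lh * Lt) <= b%:R ^+ 2) ->
  (\sum_(1 <= k < K.+1) eta k) *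
    (f (sgd_output nbm a l (fun=> s) eta x0 K) - f xs) <=
  b%:R / (2 * n%:R) * l2norm (x0 - xs) ^+ 2 +
  \sum_(1 <= k < K.+1) Num.min
    (eta k ^+ 3 * n%:R / b%:R ^+ 2 * Lh * Lt *
       wnorm (invmx (Lambda L)) (dual_opt a l xs) ^+ 2)
    (eta k ^+ 3 * (n%:R - b%:R) ^+ 2 / b%:R ^+ 2 * Lt * sigma2 a l xs).
Proof.
move=> b0 m0 K0 L0 cl sl xmin f Lh Lt step.
pose err k := Num.min
    (eta k ^+ 3 * n%:R / b%:R ^+ 2 * Lh * Lt *
       wnorm (invmx (Lambda L)) (dual_opt a l xs) ^+ 2)
    (eta k ^+ 3 * (n%:R - b%:R) ^+ 2 / b%:R ^+ 2 * Lt * sigma2 a l xs).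
rewrite -[X in _ <= _ + X]/(\sum_(1 <= k < K.+1) err k).
pose x k := shuffled_sgd nbm a l (fun=> s) eta x0 k.
have telescope : forall t, (t <= K)%N ->
    \sum_(1 <= k < t.+1) eta k * (f (x k) - f xs) <=
    b%:R / (2 * n%:R) * (l2norm (x0 - xs) ^+ 2 - l2norm (x t - xs) ^+ 2)
    + \sum_(1 <= k < t.+1) err k.
  elim=> [_|t IH tK]; first by rewrite !big_geq// subrr mulr0 addr0.
  rewrite !(big_nat_recr t.+1)//=.
  have [eta0 st] := step t.+1 tK.
  have := epoch_progress nbm a l L s (eta t.+1) (x t) xs b0 m0 eta0 L0 cl sl xmin st.
  have := IH (ltnW tK).
  rewrite -/(x t.+1) -/(err t.+1) -/f.
  clear; set A := \sum_(1 <= k < t.+1) _; set B := \sum_(1 <= k < t.+1) _.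
  lra.
have eta0 k : k \in index_iota 1 K.+1 -> 0 < eta k.
  by rewrite mem_index_iota ltnS => /step[].
have H0 : 0 < \sum_(1 <= k < K.+1) eta k.
  rewrite big_ltn// ltr_wpDr//; last by apply: eta0; rewrite mem_index_iota; exact: K0.
  rewrite big_seq sumr_ge0// => k; rewrite mem_index_iota => /andP[k2 kK].
  by rewrite ltW// eta0// mem_index_iota kK (ltnW k2).
have := objective_jensen a l L (index_iota 1 K.+1) eta x cl sl
  (fun k kr => ltW (eta0 k kr)) H0.
rewrite -/(sgd_output nbm a l (fun=> s) eta x0 K) -/f => jensen.
have := telescope K (leqnn K).
under eq_bigr => k _ do rewrite mulrBr.
rewrite sumrB -mulr_suml => tel.
have nn : 0 <= b%:R / (2 * n%:R) * l2norm (x K - xs) ^+ 2.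
  by rewrite mulr_ge0 ?sqr_ge0// divr_ge0 ?mulr_ge0.
rewrite mulrBr; apply: le_trans (lerD jensen (lexx _)) _.
by apply: le_trans tel _; rewrite lerD2r mulrBr gerBl.
Qed.

(** * From the error bound to a query complexity *)

(** Squaring removes the root and the division; for a zero denominator the
    left-hand side is zero, in agreement with the infinite bound. *)
Lemma step_bound_sqr {R : realType} (eta b n Lh Lt : R) :
  0 <= eta -> 0 <= b -> 0 <= n -> 0 <= Lh -> 0 <= Lt ->
  (eta%:E <= step_bound b (n * Num.sqrt (2 * Lh * Lt)))%E ->
  2 * eta ^+ 2 * n ^+ 2 * (Lh * Lt) <= b ^+ 2.
Proof.
move=> eta0 b0 n0 Lh0 Lt0.
have q0 : 0 <= 2 * Lh * Lt by rewrite !mulr_ge0.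
rewrite (_ : _ * (Lh * Lt) = (eta * (n * Num.sqrt (2 * Lh * Lt))) ^+ 2); last first.
  by rewrite !exprMn sqr_sqrtr//; ring.
set den := n * _; have den0 : 0 <= den by rewrite mulr_ge0.
rewrite /step_bound; case: eqVneq => [-> _|den1].
  by rewrite mulr0 expr0n/= sqr_ge0.
have denp : 0 < den by rewrite lt_neqAle eq_sym den1.
rewrite lee_fin ler_pdivlMr// => h.
by rewrite lerXn2r ?nnegrE// mulr_ge0.
Qed.

(** Here t is the step size divided by b. If D2 > 0 take t = D2 / (N eps),
    which meets the last condition with equality, and the two others are the
    two halves of the budget. If D2 = 0 the last condition is void and any
    small t works. *)
Lemma step_choice {R : realType} (D2 q P N eps : R) :
  0 <= D2 -> 0 <= q -> 0 <= P -> 0 < N -> 0 < eps ->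
  2 * (q * D2 / eps + P * D2 / (eps * Num.sqrt eps)) <= N ->
  exists2 t, 0 < t & [/\ 2 * (t * q) <= 1, 2 * (t * P) <= Num.sqrt eps &
    D2 <= t * N * eps].
Proof.
move=> D0 q0 P0 N0 e0; set r := Num.sqrt eps => h.
have r0 : 0 < r by rewrite sqrtr_gt0.
have [Dp|] := ltP 0 D2; last first.
  move=> D1; exists (2 * (q + P / r + 1))^-1.
    by rewrite invr_gt0 mulr_gt0// ltr_wpDl// addr_ge0// divr_ge0// ltW.
  have Pr0 : 0 <= P / r by rewrite divr_ge0// ltW.
  have rq := mulr_ge0 (ltW r0) q0.
  have c0 : 0 < 2 * (q + P / r + 1) by lra.
  split.
  - rewrite mulrCA mulrC ler_pdivrMr//; lra.
  - rewrite mulrCA mulrC ler_pdivrMr//.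
    have -> : r * (2 * (q + P / r + 1)) = 2 * (r * q) + 2 * P + 2 * r by field; lra.
    lra.
  - by apply: le_trans D1 _; rewrite !mulr_ge0 ?invr_ge0 ?(ltW c0)// ltW.
have qD : 0 <= q * D2 / eps by rewrite divr_ge0 ?mulr_ge0// ltW.
have PD : 0 <= P * D2 / (eps * r) by rewrite divr_ge0 ?mulr_ge0// ?ltW// mulr_gt0.
exists (D2 / (N * eps)); first by rewrite divr_gt0// mulr_gt0.
split.
- have -> : 2 * (D2 / (N * eps) * q) = 2 * (q * D2 / eps) / N by field; lra.
  by rewrite ler_pdivrMr//; lra.
- have -> : 2 * (D2 / (N * eps) * P) = r * (2 * (P * D2 / (eps * r)) / N).
    by field; rewrite !gt_eqF.
  by rewrite ler_piMr ?(ltW r0)// ler_pdivrMr//; lra.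
- by apply: eq_ler; field; lra.
Qed.

Lemma powR_three_halves {R : realType} (eps : R) :
  0 < eps -> eps `^ (3 / 2) = eps * Num.sqrt eps.
Proof.
move=> e0; rewrite -powR12_sqrt ?ltW//.
by rewrite -{2}(powRr1 (ltW e0)) -powRD ?gt_eqF// ?implybT//; congr powR; lra.
Qed.

(** Pure arithmetic of the rate: gap eta stands for the suboptimality reached
    with the constant step eta, and eta = b t with t from step_choice. The
    distance term is then at most eps / 2 and the error term at most eps / 4. *)
Lemma constant_step_rate {R : realType} (b n K Lh Lt Y sig2 D2 eps : R)
    (gap : R -> R) :
  0 < b -> b <= n -> 0 < K -> 0 <= Lh -> 0 <= Lt -> 0 <= Y -> 0 <= sig2 ->
  0 <= D2 -> 0 < eps ->
  (forall eta, 0 < eta -> 2 * eta ^+ 2 * n ^+ 2 * (Lh * Lt) <= b ^+ 2 ->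
    eta * K * gap eta <= b / (2 * n) * D2 +
      Num.min (eta ^+ 3 * n / b ^+ 2 * Lh * Lt * Y ^+ 2)
              (eta ^+ 3 * (n - b) ^+ 2 / b ^+ 2 * Lt * sig2) * K) ->
  2 * (n * Num.sqrt (Lh * Lt) * D2 / eps +
       Num.min (Num.sqrt (n * Lh * Lt) * Y)
               ((n - b) * Num.sqrt Lt * Num.sqrt sig2) * D2
       / (eps `^ (3 / 2))) <= n * K ->
  exists2 eta : R, 0 < eta & gap eta <= eps.
Proof.
move=> b0 bn K0 Lh0 Lt0 Y0 sig0 D0 e0 bound.
have n0 : 0 < n by exact: lt_le_trans bn.
have nb0 : 0 <= n - b by rewrite subr_ge0.
set M1 := Num.sqrt _ * Y; set M2 := (n - b) * _ * _; set P := Num.min M1 M2.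
have M1p : 0 <= M1 by rewrite mulr_ge0 ?sqrtr_ge0.
have M2p : 0 <= M2 by rewrite !mulr_ge0 ?sqrtr_ge0.
have P0 : 0 <= P by rewrite le_min M1p.
have M1sq : M1 ^+ 2 = n * Lh * Lt * Y ^+ 2.
  by rewrite exprMn sqr_sqrtr// !mulr_ge0// ltW.
have M2sq : M2 ^+ 2 = (n - b) ^+ 2 * Lt * sig2 by rewrite !exprMn !sqr_sqrtr.
have q0 : 0 <= n * Num.sqrt (Lh * Lt) by rewrite mulr_ge0 ?sqrtr_ge0// ltW.
have q2 : (n * Num.sqrt (Lh * Lt)) ^+ 2 = n ^+ 2 * (Lh * Lt).
  by rewrite exprMn sqr_sqrtr// mulr_ge0.
rewrite powR_three_halves// => budget.
have [t t0 [tq tP tD]] := step_choice D2 _ P _ eps D0 q0 P0 (mulr_gt0 n0 K0) e0 budget.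
have eta0 : 0 < b * t by rewrite mulr_gt0.
exists (b * t) => //.
have step : 2 * (b * t) ^+ 2 * n ^+ 2 * (Lh * Lt) <= b ^+ 2.
  rewrite -(mulrA _ (n ^+ 2)) -q2; set q := n * _ in q0 tq *.
  have -> : 2 * (b * t) ^+ 2 * q ^+ 2 = b ^+ 2 * (2 * (t * q) ^+ 2) by ring.
  rewrite ler_piMr ?sqr_ge0//.
  by move: tq (mulr_ge0 (ltW t0) q0); move: (t * q) => v; clear; nra.
rewrite -(ler_pM2l (mulr_gt0 eta0 K0)); apply: le_trans (bound _ eta0 step) _.
set err := Num.min _ (_ / _ * _ * _).
have errE : err <= b * t * (t * P) ^+ 2.
  have -> : b * t * (t * P) ^+ 2 = b * t ^+ 3 * P ^+ 2 by ring.
  rewrite /P; case: (leP M1 M2) => _; rewrite ?M1sq ?M2sq /err ge_min;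
    apply/orP; [left|right]; apply: eq_ler;
    by field; rewrite gt_eqF.
have tP2 : (t * P) ^+ 2 <= eps / 4.
  rewrite -(sqr_sqrtr (ltW e0)); move: tP (mulr_ge0 (ltW t0) P0).
  by move: (t * P) (Num.sqrt eps) => v w; clear; nra.
have err4 : err * K <= b * t * (eps / 4) * K.
  by rewrite ler_wpM2r ?(ltW K0)//; apply: le_trans errE _; rewrite ler_wpM2l ?(ltW eta0).
have dist : b / (2 * n) * D2 <= b * t * K * eps / 2.
  have -> : b * t * K * eps / 2 = b / (2 * n) * (t * (n * K) * eps).
    by field; rewrite gt_eqF.
  by rewrite ler_wpM2l// divr_ge0 ?mulr_ge0// ltW.
have : 0 <= b * t * K * eps by rewrite !mulr_ge0// ltW.
lra.
Qed.

Theorem theorem2 (R : realType) :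
  exists2 C : R, 0 < C &
  forall (n d b m : nat) (nbm : n = (b * m)%N)
    (a : 'I_n -> 'cV[R]_d) (l : 'I_n -> R -> R) (L : 'I_n -> R)
    (s0 : 'S_n) (x0 xs : 'cV[R]_d),
  (0 < n)%N -> (0 < d)%N -> (0 < b)%N -> (0 < m)%N ->
  (forall i, 0 < L i) ->
  (forall i, convex_function [set: R^o] (l i)) ->
  (forall i, smooth (L i) (l i)) ->
  (forall x, objective a l xs <= objective a l x) ->
  let f := objective a l in
  let Lh := Lhat b m a L s0 in
  let Lt := Ltilde b m a L s0 in
  let ynorm := wnorm (invmx (Lambda L)) (dual_opt a l xs) in
  let sig2 := sigma2 a l xs in
  let D2 := l2norm (x0 - xs) ^+ 2 in
  let xhat := sgd_output nbm a l (fun _ => s0) in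
  (forall (K : nat) (eta : nat -> R),
    (0 < K)%N ->
    (forall k, (1 <= k <= K)%N ->
       0 < eta k /\
       ((eta k)%:E <= step_bound b%:R (n%:R * Num.sqrt (2 * Lh * Lt)))%E) ->
    (\sum_(1 <= k < K.+1) eta k) * (f (xhat eta x0 K) - f xs) <=
      b%:R / (2 * n%:R) * D2 +
      \sum_(1 <= k < K.+1)
        Num.min (eta k ^+ 3 * n%:R / b%:R ^+ 2 * Lh * Lt * ynorm ^+ 2)
                (eta k ^+ 3 * (n%:R - b%:R) ^+ 2 / b%:R ^+ 2 * Lt * sig2))
  /\
  (forall (eps : R) (K : nat),
    0 < eps -> (0 < K)%N ->
    C * (n%:R * Num.sqrt (Lh * Lt) * D2 / eps +
         Num.min (Num.sqrt (n%:R * Lh * Lt) * ynorm)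
                 ((n%:R - b%:R) * Num.sqrt Lt * Num.sqrt sig2) * D2
         / (eps `^ (3 / 2))) <= n%:R * K%:R ->
    exists2 eta : R, 0 < eta & f (xhat (fun _ => eta) x0 K) - f xs <= eps).
Proof.
exists 2 => // n d b m nbm a l L s0 x0 xs n0 d0 b0 m0 L0 cl sl xmin.
move=> f Lh Lt ynorm sig2 D2 xhat; split=> [K eta K0 step|eps K e0 K0 budget].
  apply: sgd_bound => // k /step[eta0 bnd]; split=> //.
  by apply: step_bound_sqr bnd; rewrite ?ler0n ?Lhat_ge0 ?Ltilde_ge0// ltW.
have [b0R K0R] : 0 < b%:R :> R /\ 0 < K%:R :> R by rewrite !ltr0n.
have bn : b%:R <= n%:R :> R by rewrite ler_nat nbm leq_pmulr.
have sig0 : 0 <= sig2.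
  rewrite mulr_ge0 ?invr_ge0// sumr_ge0// => i _.
  by rewrite mulr_ge0 ?sqr_ge0.
apply: (constant_step_rate b%:R n%:R K%:R Lh Lt ynorm sig2 D2 eps
  (fun eta => f (xhat (fun=> eta) x0 K) - f xs) b0R bn K0R (Lhat_ge0 _ _ _ _ _)
  (Ltilde_ge0 _ _ _ _ _) (sqrtr_ge0 _) sig0 (sqr_ge0 _) e0 _ budget).
move=> eta eta0 step.
have := sgd_bound nbm a l L s0 x0 xs K (fun=> eta) b0 m0 K0 L0 cl sl xmin
  (fun k _ => conj eta0 step).
by rewrite !sumr_const_nat subn1 -[eta *+ _]mulr_natr -[X in _ <= _ + X]mulr_natr.
Qed.
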